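(* Let $S\subset\mathbb{R}$ be one of $\mathbb{Z}_{\geq 0}$, $\mathbb{Z}$, or $\mathbb{Q}$. Then for every support-preserving endomorphism $\Phi$ of $\mathrm{Prob}(S)$ there exists a constant $\beta\in\mathbb{R}$ such that $\Phi=\Phi_\beta$, i.e. for all $\mu\in\mathrm{Prob}(S)$ and $s\in S$, $$\Phi[\mu](s)=\frac{\mu(s)e^{-\beta s}}{\sum_{t\in S}\mu(t)e^{-\beta t}}.$$
   Context: For $S\subseteq\mathbb{R}$ closed under addition, $\mathrm{Prob}(S)$ denotes the set of finitely supported probability measures on $S$, which is a semigroup under convolution $*$. A map $\Phi\colon\mathrm{Prob}(S)\to\mathrm{Prob}(S)$ is support-preserving if $\mu$ and $\Phi[\mu]$ have the same support for every $\mu\in\mathrm{Prob}(S)$. It is an endomorphism if $\Phi[\mu_1*\mu_2]=\Phi[\mu_1]*\Phi[\mu_2]$ for all $\mu_1,\mu_2\in\mathrm{Prob}(S)$. For $\beta\in\mathbb{R}$, $\Phi_\beta\colon\mathrm{Prob}(S)\to\mathrm{Prob}(S)$ is the map $\Phi_\beta[\mu](s)=\mu(s)e^{-\beta s}/\sum_t\mu(t)e^{-\beta t}$. *)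

(* Defs.v *)
From mathcomp Require Import all_boot all_order all_algebra.
From mathcomp Require Import finmap.
From mathcomp Require Import all_classical all_reals all_analysis.
Import Order.TTheory GRing.Theory Num.Theory.

Set Implicit Arguments.
Unset Strict Implicit.
Unset Printing Implicit Defensive.

Local Open Scope classical_set_scope.
Local Open Scope ring_scope.

Record addset (R : realType) := AddSet {
  addset_set :> set R;
  addsetD : forall x y, addset_set x -> addset_set y -> addset_set (x + y) }.

(* Prob(S).  A finitely supported measure on S is encoded by its mass function,
   extended by 0 to the whole of R; [finsupp mu] is then its support. *)
Record prob (R : realType) (S : addset R) := Prob {
  mass :> {fsfun R -> R with 0};
  mass_ge0 : forall x, 0 <= mass x;
  mass_sum1 : \sum_(x <- finsupp mass) mass x = 1;
  mass_supp : [set` finsupp mass] `<=` S }.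

Lemma prob_eqP (R : realType) (S : addset R) (mu nu : prob S) :
  (forall x, mu x = nu x) -> mu = nu.
Proof.
case: mu nu => [f f0 f1 fS] [g g0 g1 gS] /= fg.
have {}fg : f = g by apply/fsfunP.
by subst g; congr Prob; exact: Prop_irrelevance.
Qed.

Section Convolution.
Context (R : realType) (S : addset R) (mu nu : prob S).

Definition conv_dom : {fset R} :=
  [fset (x + y)%R | x in finsupp mu, y in finsupp nu]%fset.

Definition conv_mass : {fsfun R -> R with 0} :=
  [fsfun z in conv_dom =>
    \sum_(x <- finsupp mu) \sum_(y <- finsupp nu | x + y == z) mu x * nu y].

Lemma conv_massE z : conv_mass z =
  \sum_(x <- finsupp mu) \sum_(y <- finsupp nu | x + y == z) mu x * nu y.
Proof.
rewrite fsfunE; case: ifPn => // zNdom.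
rewrite big_seq big1// => x xmu; rewrite big_seq_cond big1// => y.
case/andP => ynu /eqP xyz; case/negP: zNdom.
by rewrite -xyz; exact: in_imfset2.
Qed.

Lemma conv_mass_ge0 z : 0 <= conv_mass z.
Proof.
rewrite conv_massE; apply: sumr_ge0 => x _; apply: sumr_ge0 => y _.
by rewrite mulr_ge0// mass_ge0.
Qed.

Lemma conv_mass_dom : (finsupp conv_mass `<=` conv_dom)%fset.
Proof.
apply/fsubsetP => z; rewrite mem_finsupp fsfunE.
by case: ifP => //; rewrite eqxx.
Qed.

Lemma conv_mass_sum1 : \sum_(z <- finsupp conv_mass) conv_mass z = 1.
Proof.
rewrite (big_fset_incl _ conv_mass_dom); last first.
  by move=> z _; rewrite memNfinsupp => /eqP.
under eq_bigr do rewrite conv_massE.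
rewrite exchange_big/= -[RHS](mass_sum1 mu) big_seq [RHS]big_seq.
apply: eq_bigr => x xmu; under eq_bigr do rewrite big_mkcond.
rewrite exchange_big/= -[RHS]mulr1 -(mass_sum1 nu) mulr_sumr.
rewrite big_seq [RHS]big_seq; apply: eq_bigr => y ynu.
rewrite (big_fsetD1 (x + y)) ?in_imfset2//= eqxx big_seq big1 ?addr0// => z.
by rewrite !inE eq_sym => /andP[/negPf ->].
Qed.

Lemma conv_mass_supp z : z \in finsupp conv_mass -> (S : set R) z.
Proof.
move=> /(fsubsetP conv_mass_dom) /imfset2P[x xmu [y ynu ->]].
by apply: addsetD; [exact: mass_supp xmu|exact: mass_supp ynu].
Qed.

Definition conv : prob S := Prob conv_mass_ge0 conv_mass_sum1 conv_mass_supp.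

End Convolution.

Section Tilt.
Context (R : realType) (S : addset R) (beta : R) (mu : prob S).

Definition tilt_mass : {fsfun R -> R with 0} :=
  [fsfun s in finsupp mu =>
    mu s * expR (- beta * s) /
    \sum_(t <- finsupp mu) mu t * expR (- beta * t)].

Lemma tilt_massE s : tilt_mass s =
  mu s * expR (- beta * s) / \sum_(t <- finsupp mu) mu t * expR (- beta * t).
Proof.
by rewrite fsfunE; case: ifPn => // /fsfun_dflt ->; rewrite !mul0r.
Qed.

Lemma tilt_sum_gt0 : 0 < \sum_(t <- finsupp mu) mu t * expR (- beta * t).
Proof.
have ge0 t : 0 <= mu t * expR (- beta * t).
  by rewrite mulr_ge0 ?mass_ge0 ?expR_ge0.
rewrite lt_neqAle sumr_ge0 ?andbT// eq_sym; apply/negP => /eqP /eqP.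
rewrite psumr_eq0// => /allP mu0.
have := mass_sum1 mu; rewrite big_seq big1 => [/esym/eqP|t /[dup] tmu /mu0].
  by rewrite oner_eq0.
by rewrite mulf_eq0 (gt_eqF (expR_gt0 _)) orbF => /eqP.
Qed.

Lemma tilt_mass_ge0 s : 0 <= tilt_mass s.
Proof.
rewrite tilt_massE divr_ge0 ?(ltW tilt_sum_gt0)//.
by rewrite mulr_ge0 ?mass_ge0 ?expR_ge0.
Qed.

Lemma finsupp_tilt_mass : finsupp tilt_mass = finsupp mu.
Proof.
apply/fsetP => s; rewrite !mem_finsupp tilt_massE !mulf_eq0 invr_eq0.
by rewrite (gt_eqF tilt_sum_gt0) (gt_eqF (expR_gt0 _)) !orbF.
Qed.

Lemma tilt_mass_sum1 : \sum_(s <- finsupp tilt_mass) tilt_mass s = 1.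
Proof.
rewrite finsupp_tilt_mass; under eq_bigr do rewrite tilt_massE.
by rewrite -mulr_suml divff// gt_eqF// tilt_sum_gt0.
Qed.

Lemma tilt_mass_supp s : s \in finsupp tilt_mass -> (S : set R) s.
Proof. by rewrite finsupp_tilt_mass => /mass_supp. Qed.

(* The map Phi_beta. *)
Definition tilt : prob S := Prob tilt_mass_ge0 tilt_mass_sum1 tilt_mass_supp.

End Tilt.

Definition support_preserving (R : realType) (S : addset R)
    (Phi : prob S -> prob S) : Prop :=
  forall mu, finsupp (Phi mu) = finsupp mu.

Definition conv_endomorphism (R : realType) (S : addset R)
    (Phi : prob S -> prob S) : Prop :=
  forall mu1 mu2, Phi (conv mu1 mu2) = conv (Phi mu1) (Phi mu2).

(* Main.v *)
(* Push measures on the lattice eN to their generating polynomials.  After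
   dividing by the constant coefficient, Phi becomes a multiplicative map N on
   polynomials with nonnegative coefficients and p(0) = 1 which preserves the
   set of nonzero coefficients.  No continuity is assumed: rigidity comes from
   products in which some coefficient cancels.

   Write N(1 + tX) = 1 + f(t)X.  The two factorizations of
   1 + tX + ... + (tX)^5 give N(1 + t^3 X^3) = 1 + f(t)^3 X^3, so N extends to
   1 - tX + t^2 X^2 = (1 + t^3 X^3) / (1 + tX).  Multiplying 1 + aX + bX^2
   (where b <= a^2) by 1 - aX + a^2 X^2 kills the coefficient of X and leaves
   the others nonnegative; hence the coefficient of X in N(1 + aX + bX^2) is
   f(a).  Applied to (1 + sX)(1 + tX) this says that f is additive, and being
   positive it is linear, f(t) = ct.  After rescaling to c = 1, the same
   cancellations show that N fixes 1 + aX + bX^2 for a >= 0, and the Graeffe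
   identity extends this to all quadratics without positive roots.  Since a
   polynomial with nonnegative coefficients has no positive root, it factors
   over the reals into polynomials fixed by N.

   An arbitrary measure on S is carried to some lattice (1/d)N by a
   translation, and comparing (1/d)N with N shows that c^d does not depend
   on d. *)
Require Import Defs.
From mathcomp Require Import all_boot all_order all_algebra.
From mathcomp Require Import finmap.
From mathcomp Require Import all_classical all_reals all_analysis.
From mathcomp Require Import ring lra complex.
Import Order.TTheory GRing.Theory Num.Theory.

Set Implicit Arguments.
Unset Strict Implicit.
Unset Printing Implicit Defensive.

Local Open Scope classical_set_scope.
Local Open Scope ring_scope.

Local Arguments Poly {R} s : simpl never.

(** * Support-preserving multiplicative maps on polynomials *)

Section Cone.
Context (R : realType).
Implicit Types (p q g u v : {poly R}) (N : {poly R} -> {poly R}) (a b c r s t x : R).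

(** The constant coefficient 1 keeps the set closed under products and makes its members nonzero,
    hence cancellable. *)
Definition nneg1 p := p`_0 = 1 /\ forall i, 0 <= p`_i.

Record support_multiplicative N : Prop := SupportMultiplicative {
  smult_nneg1 : forall p, nneg1 p -> nneg1 (N p);
  smult_eq0 : forall p i, nneg1 p -> ((N p)`_i == 0) = (p`_i == 0);
  smultM : forall p q, nneg1 p -> nneg1 q -> N (p * q) = N p * N q }.

Lemma nneg1_Poly (w : seq R) : all (fun x => 0 <= x) w -> nneg1 (Poly (1 :: w)).
Proof.
move=> w0; split=> [|i]; rewrite coef_Poly//.
case: i => [|i] /=; first exact: ler01.
have [iw|iw] := ltnP i (size w); first exact: (all_nthP 0 w0).
by rewrite nth_default.
Qed.

Lemma nneg1_1 : nneg1 1.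
Proof. by split=> [|i]; rewrite coef1 ?eqxx// ler0n. Qed.

Lemma nneg1M p q : nneg1 p -> nneg1 q -> nneg1 (p * q).
Proof.
move=> [p0 pge0] [q0 qge0]; split=> [|i]; first by rewrite coef0M p0 q0 mulr1.
by rewrite coefM sumr_ge0// => j _; rewrite mulr_ge0.
Qed.

Lemma nneg1_neq0 p : nneg1 p -> p != 0.
Proof. by case=> + _; apply: contra_eq_neq => ->; rewrite coef0 eq_sym oner_eq0. Qed.

Lemma nneg1_comp_Xn p k : (0 < k)%N -> nneg1 p -> nneg1 (p \Po 'X^k).
Proof.
move=> k0 [p0 pge0]; split=> [|i]; rewrite coef_comp_poly_Xn ?dvdn0 ?div0n//.
by case: ifP.
Qed.

Lemma poly_mkseq n p : (size p <= n)%N -> p = Poly (mkseq (nth 0 p) n).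
Proof.
move=> pn; apply/polyP => i; rewrite coef_Poly.
have [ni|ni] := ltnP i n; first by rewrite nth_mkseq.
by rewrite !nth_default ?size_mkseq// (leq_trans pn).
Qed.

(* [g] is the quotient [v / u] in [nneg1], and [g'] is the quotient of the images:
   [N] thereby extends to some polynomials with negative coefficients. *)
Definition extends N g g' := exists u v,
  [/\ nneg1 u, nneg1 v, u * g = v & N u * g' = N v].

Section SupportMultiplicative.
Context (N : {poly R} -> {poly R}) (smN : support_multiplicative N).

Lemma smult_coef0 p : nneg1 p -> (N p)`_0 = 1.
Proof. by move=> /(smult_nneg1 smN)[]. Qed.

Lemma smult_coef_gt0 p i : nneg1 p -> 0 < p`_i -> 0 < (N p)`_i.
Proof.
move=> p1 pi; rewrite lt_neqAle eq_sym (smult_eq0 smN)// gt_eqF//=.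
by case: (smult_nneg1 smN p1).
Qed.

Lemma smult_coef_eq0 p i : nneg1 p -> p`_i = 0 -> (N p)`_i = 0.
Proof. by move=> p1 /eqP pi; apply/eqP; rewrite (smult_eq0 smN). Qed.

Lemma size_smult p : nneg1 p -> (size (N p) <= size p)%N.
Proof.
by move=> p1; apply/leq_sizeP => i pi; rewrite smult_coef_eq0// nth_default.
Qed.

Lemma smult1 : N 1 = 1.
Proof.
have := size_smult nneg1_1; rewrite size_poly1 => /size1_polyC ->.
by rewrite smult_coef0//; exact: nneg1_1.
Qed.

Lemma smult_mkseq n p : nneg1 p -> (size p <= n.+1)%N ->
  N p = Poly (1 :: mkseq (fun i => (N p)`_i.+1) n).
Proof.
move=> p1 pn; rewrite {1}(@poly_mkseq n.+1 (N _)); last first.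
  exact: leq_trans (size_smult p1) pn.
congr Poly; apply: (@eq_from_nth _ 0); rewrite ?size_mkseq//= ?size_mkseq//.
by case=> [|i] iw; rewrite nth_mkseq//= ?nth_mkseq// smult_coef0.
Qed.

Lemma extends_nneg1 p : nneg1 p -> extends N p (N p).
Proof.
by move=> p1; exists 1, p; rewrite !mul1r smult1 mul1r; split => //; exact: nneg1_1.
Qed.

Lemma extendsM g g' h h' :
  extends N g g' -> extends N h h' -> extends N (g * h) (g' * h').
Proof.
move=> [u [v [u1 v1 uv Nuv]]] [w [z [w1 z1 wz Nwz]]].
exists (u * w), (v * z); split; [exact: nneg1M|exact: nneg1M| |].
  by rewrite -uv -wz; ring.
by rewrite !(smultM smN)// -Nuv -Nwz; ring.
Qed.

Lemma extends_nneg1_eq p p' : nneg1 p -> extends N p p' -> N p = p'.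
Proof.
move=> p1 [u [v [u1 v1 uv Nuv]]]; apply: (@mulfI _ (N u)).
  exact/nneg1_neq0/smult_nneg1.
by rewrite Nuv -uv (smultM smN).
Qed.

(** This is how the extension is used: [g] may have negative coefficients as long as [p * g] has
    none, and each coefficient that vanishes in [p * g] gives a linear equation on those of
    [N p]. *)
Lemma smultM_extends p g g' :
  nneg1 p -> nneg1 (p * g) -> extends N g g' -> N (p * g) = N p * g'.
Proof.
move=> p1 pg1 gg'; apply: extends_nneg1_eq => //.
by apply: extendsM => //; exact: extends_nneg1.
Qed.

Definition slope t := (N (Poly [:: 1; t]))`_1.

Lemma smult_linear t : 0 <= t -> N (Poly [:: 1; t]) = Poly [:: 1; slope t].
Proof.
move=> t0; apply: (@smult_mkseq 1); last exact: size_Poly.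
by apply: nneg1_Poly; rewrite /= t0.
Qed.

Lemma slope_gt0 t : 0 < t -> 0 < slope t.
Proof.
move=> t0; apply: smult_coef_gt0; last by rewrite coef_Poly.
by apply: nneg1_Poly; rewrite /= ltW.
Qed.

(* [1 + tX + ... + (tX)^5] is both [(1 + tX) * (1 + t^2X^2 + t^4X^4)] and
   [(1 + tX + t^2X^2) * (1 + t^3X^3)]. *)
Lemma smult_hexagon t : 0 < t ->
  N (Poly [:: 1; 0; 0; t ^+ 3]) = Poly [:: 1; 0; 0; slope t ^+ 3] /\
  N (Poly [:: 1; 0; t ^+ 2; 0; t ^+ 4]) =
    Poly [:: 1; 0; slope t ^+ 2; 0; slope t ^+ 4].
Proof.
move=> t0; have [t2 t3 t4] : [/\ 0 <= t ^+ 2, 0 <= t ^+ 3 & 0 <= t ^+ 4].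
  by rewrite !exprn_ge0 ?ltW.
set L := Poly [:: 1; t]; set A := Poly [:: 1; t; t ^+ 2].
set B := Poly [:: 1; 0; 0; t ^+ 3]; set D := Poly [:: 1; 0; t ^+ 2; 0; t ^+ 4].
have L1 : nneg1 L by apply: nneg1_Poly; rewrite /= ltW.
have A1 : nneg1 A by apply: nneg1_Poly; rewrite /= (ltW t0) t2.
have B1 : nneg1 B by apply: nneg1_Poly; rewrite /= lexx t3.
have D1 : nneg1 D by apply: nneg1_Poly; rewrite /= lexx t2 t4.
have eqLD : L * D = A * B by rewrite /L /A /B /D /Poly /= !cons_poly_def; ring.
have := congr1 N eqLD; rewrite !(smultM smN)//.
rewrite smult_linear ?ltW// (smult_mkseq A1 (size_Poly _)).
rewrite (smult_mkseq B1 (size_Poly _)) (smult_mkseq D1 (size_Poly _)).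
rewrite /mkseq /=.
have -> : (N B)`_1 = 0 by rewrite smult_coef_eq0// coef_Poly.
have -> : (N B)`_2 = 0 by rewrite smult_coef_eq0// coef_Poly.
have -> : (N D)`_1 = 0 by rewrite smult_coef_eq0// coef_Poly.
have -> : (N D)`_3 = 0 by rewrite smult_coef_eq0// coef_Poly.
have : (N B)`_3 != 0 by rewrite (smult_eq0 smN)// coef_Poly/= expf_neq0// gt_eqF.
move: (slope t) (N A)`_1 (N A)`_2 (N B)`_3 (N D)`_2 (N D)`_4.
move=> F u v C al be C0 E; have cE i := congr1 (fun p => p`_i) E.
move: (cE 1%N) (cE 2%N) (cE 3%N) (cE 4%N) (cE 5%N).
rewrite !coefM !(big_ord_recl, big_ord0) !coef_Poly /= => E1 E2 E3 E4 E5.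
have uF : u = F by lra.
have alv : al = v by lra.
have CE : C = F * v by rewrite -alv; lra.
have beE : be = F * C by rewrite uF in E4; lra.
(* The coefficient of ['X^5] gives [F * be = v * C]; since [be = F * C], the nonzero [C] cancels. *)
have vE : v = F ^+ 2 by apply: (mulIf C0); rewrite uF in E5; subst be; lra.
by rewrite alv beE CE vE -!exprS.
Qed.

Lemma extends_alternating t : 0 < t ->
  extends N (Poly [:: 1; - t; t ^+ 2]) (Poly [:: 1; - slope t; slope t ^+ 2]).
Proof.
move=> t0; exists (Poly [:: 1; t]), (Poly [:: 1; 0; 0; t ^+ 3]); split.
- by apply: nneg1_Poly; rewrite /= ltW.
- by apply: nneg1_Poly; rewrite /= lexx exprn_ge0// ltW.
- by rewrite /Poly /= !cons_poly_def; ring.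
- rewrite (smult_hexagon t0).1 smult_linear ?ltW//.
  by rewrite /Poly /= !cons_poly_def; ring.
Qed.

(* The multiplier is chosen to cancel the coefficient of ['X]. *)
Lemma smult_quadratic_coef1 a b : 0 < a -> 0 <= b <= a ^+ 2 ->
  (N (Poly [:: 1; a; b]))`_1 = slope a.
Proof.
move=> a0 /andP[b0 ba].
have p1 : nneg1 (Poly [:: 1; a; b]) by apply: nneg1_Poly; rewrite /= ltW// b0.
have pgE : Poly [:: 1; a; b] * Poly [:: 1; - a; a ^+ 2] =
    Poly [:: 1; 0; b; a * (a ^+ 2 - b); b * a ^+ 2].
  by rewrite /Poly /= !cons_poly_def; ring.
have pg1 : nneg1 (Poly [:: 1; a; b] * Poly [:: 1; - a; a ^+ 2]).
  rewrite pgE; apply: nneg1_Poly.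
  by rewrite /= lexx b0 !mulr_ge0 ?exprn_ge0 ?subr_ge0// ltW.
have := smultM_extends p1 pg1 (extends_alternating a0).
move=> /(congr1 (fun p => p`_1)); rewrite smult_coef_eq0 ?pgE ?coef_Poly//.
  by rewrite coefM !big_ord_recl big_ord0 /= !coef_Poly /= smult_coef0//; lra.
by rewrite -pgE.
Qed.

Lemma slopeD a b : 0 < a -> 0 < b -> slope (a + b) = slope a + slope b.
Proof.
move=> a0 b0; rewrite -(@smult_quadratic_coef1 (a + b) (a * b)).
- have -> : Poly [:: 1; a + b; a * b] = Poly [:: 1; a] * Poly [:: 1; b].
    by rewrite /Poly /= !cons_poly_def; ring.
  rewrite (smultM smN) ?smult_linear ?ltW//;
    try by apply: nneg1_Poly; rewrite /= ltW.
  by rewrite coefM !big_ord_recl big_ord0 /= !coef_Poly /=; lra.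
- exact: addr_gt0.
- by rewrite mulr_ge0 ?ltW//=; nra.
Qed.

Lemma slope_mulrn t n : 0 < t -> slope (t *+ n.+1) = slope t *+ n.+1.
Proof.
move=> t0; elim: n => [//|n IHn].
by rewrite mulrS slopeD ?pmulrn_lgt0// IHn -mulrS.
Qed.

Lemma slope_homo s t : 0 < s -> s < t -> slope s < slope t.
Proof.
move=> s0 st; rewrite -[t](subrK s) slopeD ?subr_gt0//.
by rewrite ltrDr slope_gt0// subr_gt0.
Qed.

(** An additive increasing function on the positive reals is homogeneous, by the Archimedean
    property. Exchanging [s] and [t] turns the inequality into an equality. *)
Lemma slope_ratio s t : 0 < s -> 0 < t -> slope s * t <= slope t * s.
Proof.
move=> s0 t0; rewrite leNgt; apply/negP => lt_ts.
set d := slope s * t - slope t * s; have d0 : 0 < d by rewrite subr_gt0.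
(* [n.+1] copies of the gap [d] exceed [slope t * t], which is the most that rounding [n.+1 * s / t]
   up to [m.+1] can cost. *)
pose n := Num.truncn (slope t * t / d).
have nd : slope t * t < n.+1%:R * d.
  by rewrite -ltr_pdivrMr// truncnS_gt.
pose m := Num.truncn (n.+1%:R * s / t).
have ns0 : 0 <= n.+1%:R * s / t by rewrite !mulr_ge0 ?invr_ge0 ?ltW.
have [mle mgt] : m%:R * t <= n.+1%:R * s /\ n.+1%:R * s < m.+1%:R * t.
  by rewrite -ler_pdivlMr// -ltr_pdivrMr// truncnS_gt truncn_le.
have : slope (s *+ n.+1) < slope (t *+ m.+1).
  apply: slope_homo; first by rewrite pmulrn_lgt0.
  by rewrite -[s *+ _]mulr_natl -[t *+ _]mulr_natl.
rewrite !slope_mulrn// -[slope s *+ _]mulr_natl -[slope t *+ _]mulr_natl => Fst.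
have Ft := slope_gt0 t0.
have : n.+1%:R * slope s * t < (m%:R + 1) * slope t * t.
  by rewrite ltr_pM2r// natr1.
have : m%:R * t * slope t <= n.+1%:R * s * slope t by rewrite ler_pM2r.
by move: nd; rewrite /d; lra.
Qed.

Lemma slopeE t : 0 < t -> slope t = slope 1 * t.
Proof.
move=> t0; apply: le_anti.
have := slope_ratio t0 ltr01; have := slope_ratio ltr01 t0.
by rewrite !mulr1 => -> ->.
Qed.

End SupportMultiplicative.
End Cone.

(** * Even polynomials, normalization, and fixed quadratics *)

Section Contraction.
Context (R : realType).
Implicit Types (p q g u v : {poly R}) (N : {poly R} -> {poly R}) (a b c r s t x : R).

(** The action of [N] on polynomials in ['X^2]. Since [N] preserves supports, its values there are
    even and [even_poly] loses nothing. *)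
Definition contract N p := even_poly (N (p \Po 'X^2)).

Lemma contract_comp N p : support_multiplicative N -> nneg1 p ->
  contract N p \Po 'X^2 = N (p \Po 'X^2).
Proof.
move=> smN p1; apply/polyP => i; rewrite coef_comp_poly_Xn// coef_even_poly.
case: ifPn => [/dvdnP[k ->]|i2]; first by rewrite mulnK// muln2.
rewrite smult_coef_eq0//; first exact: nneg1_comp_Xn.
by rewrite coef_comp_poly_Xn// (negPf i2).
Qed.

Lemma comp_Xn_inj k : (0 < k)%N -> injective (comp_poly ('X^k : {poly R})).
Proof.
move=> k0 p q pq; apply/polyP => i.
have := congr1 (fun p => p`_(i * k)) pq.
by rewrite !coef_comp_poly_Xn// dvdn_mull// mulnK.
Qed.

Lemma contract_smult N : support_multiplicative N -> support_multiplicative (contract N).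
Proof.
move=> smN; have c1 p : nneg1 p -> nneg1 (p \Po 'X^2) by exact: nneg1_comp_Xn.
split=> [p p1|p i p1|p q p1 q1].
- have [N0 Nge0] := smult_nneg1 smN (c1 p p1).
  by split=> [|i]; rewrite coef_even_poly.
- rewrite coef_even_poly (smult_eq0 smN _ (c1 p p1)).
  by rewrite coef_comp_poly_Xn// -muln2 dvdn_mull// mulnK.
- apply: (@comp_Xn_inj 2) => //; rewrite /= comp_polyM !contract_comp//.
    by rewrite comp_polyM (smultM smN)//; exact: c1.
  exact: nneg1M.
Qed.

(** The coefficient of ['X^2] in the image of [1 + t^2X^2 + t^4X^4] is computed twice: by
    [smult_hexagon] for [N], and by [smult_quadratic_coef1] for [contract N] in the boundary case
    [b = a^2]. *)
Lemma slope_contract N t : support_multiplicative N -> 0 < t ->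
  slope (contract N) (t ^+ 2) = slope N t ^+ 2.
Proof.
move=> smN t0; have smN2 := contract_smult smN.
rewrite -(@smult_quadratic_coef1 _ _ smN2 _ (t ^+ 4)).
- rewrite /contract coef_even_poly.
  have -> : Poly [:: 1; t ^+ 2; t ^+ 4] \Po 'X^2 =
      Poly [:: 1; 0; t ^+ 2; 0; t ^+ 4].
    rewrite /Poly /= !cons_poly_def !(comp_polyD, comp_polyM, comp_polyC, comp_polyX).
    by ring.
  by rewrite (smult_hexagon smN t0).2 coef_Poly.
- exact: exprn_gt0.
- by rewrite -exprM lexx andbT exprn_ge0 ?ltW.
Qed.

Lemma coef_comp_polyZX p c i : (p \Po (c *: 'X))`_i = p`_i * c ^+ i.
Proof.
rewrite coef_comp_poly; under eq_bigr do rewrite exprZn coefZ coefXn.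
have [ip|ip] := ltnP i (size p).
  rewrite (bigD1 (Ordinal ip))//= eqxx mulr1 big1 ?addr0// => j ji.
  by rewrite eq_sym -[_ == _]/(j == Ordinal ip) (negPf ji) !mulr0.
rewrite (nth_default _ ip) mul0r big1// => j _.
by rewrite gtn_eqF ?mulr0// (leq_trans (ltn_ord j)).
Qed.

Lemma rescale_smult N c : support_multiplicative N -> 0 < c ->
  support_multiplicative (fun p => N p \Po (c *: 'X)).
Proof.
move=> smN c0; split=> [p p1|p i p1|p q p1 q1].
- have [N0 Nge0] := smult_nneg1 smN p1.
  split=> [|i]; rewrite coef_comp_polyZX ?N0 ?mulr1//.
  by rewrite mulr_ge0// exprn_ge0// ltW.
- by rewrite coef_comp_polyZX mulf_eq0 expf_eq0 (gt_eqF c0) andbF orbF smult_eq0.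
- by rewrite (smultM smN)// comp_polyM.
Qed.

Lemma slope_rescale N c t :
  slope (fun p => N p \Po (c *: 'X)) t = slope N t * c.
Proof. by rewrite /slope coef_comp_polyZX. Qed.

Definition normalized N := support_multiplicative N /\
  forall t, 0 < t -> slope N t = t.

Lemma contract_normalized N : normalized N -> normalized (contract N).
Proof.
move=> [smN N1]; split=> [|t t0]; first exact: contract_smult.
rewrite -[in LHS](@sqr_sqrtr _ t) ?ltW// slope_contract ?sqrtr_gt0//.
by rewrite N1 ?sqrtr_gt0// sqr_sqrtr// ltW.
Qed.

Section Normalized.
Context N (nN : normalized N).
Let smN := nN.1.

Lemma fix_linear t : 0 <= t -> N (Poly [:: 1; t]) = Poly [:: 1; t].
Proof.
rewrite le_eqVlt => /predU1P[<-|t0].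
  have -> : Poly [:: 1; 0] = 1 :> {poly R}.
    by rewrite /Poly /= !cons_poly_def; ring.
  exact: smult1.
by rewrite smult_linear ?ltW// nN.2.
Qed.

Lemma extends_fix_alternating t : 0 < t ->
  extends N (Poly [:: 1; - t; t ^+ 2]) (Poly [:: 1; - t; t ^+ 2]).
Proof. by move=> t0; rewrite -{3 4}(nN.2 _ t0); exact: extends_alternating. Qed.

(* After multiplication by [1 + cX] the polynomial becomes palindromic up to
   scaling of ['X], and then multipliers [1 - tX + t^2X^2] exist which cancel the coefficient of ['X],
   respectively of ['X^4], and keep all other coefficients nonnegative. *)
Lemma fix_quadratic_gt0 a c : 0 < a -> 0 < c ->
  N (Poly [:: 1; a; c ^+ 2]) = Poly [:: 1; a; c ^+ 2].
Proof.
move=> a0 c0; set q := Poly _.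
have q1 : nneg1 q by apply: nneg1_Poly; rewrite /= ltW// exprn_ge0// ltW.
rewrite (smult_mkseq smN q1 (size_Poly _)) /mkseq /=.
pose p := q * Poly [:: 1; c].
have l1 : nneg1 (Poly [:: 1; c]) by apply: nneg1_Poly; rewrite /= ltW.
have p1 : nneg1 p by exact: nneg1M.
have Np : N p = N q * Poly [:: 1; c] by rewrite (smultM smN)// fix_linear// ltW.
rewrite (smult_mkseq smN q1 (size_Poly _)) /mkseq /= in Np.
have cancel_coef t i : 0 < t -> nneg1 (p * Poly [:: 1; - t; t ^+ 2]) ->
    (p * Poly [:: 1; - t; t ^+ 2])`_i = 0 ->
    (N p * Poly [:: 1; - t; t ^+ 2])`_i = 0.
  move=> t0 pg1; rewrite -(smultM_extends smN p1 pg1 (extends_fix_alternating t0)).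
  exact: smult_coef_eq0.
have pgE t : p * Poly [:: 1; - t; t ^+ 2] =
    Poly [:: 1; a + c - t; c * (a + c) - t * (a + c) + t ^+ 2;
             c ^+ 3 - t * (c * (a + c)) + t ^+ 2 * (a + c);
             t ^+ 2 * (c * (a + c)) - t * c ^+ 3; t ^+ 2 * c ^+ 3].
  by rewrite /p /q /Poly /= !cons_poly_def; ring.
set d := a + c in pgE; have d0 : 0 < d by exact: addr_gt0.
have : (N p * Poly [:: 1; - d; d ^+ 2])`_1 = 0.
  apply: cancel_coef => //; rewrite pgE ?coef_Poly/= ?subrr//; apply: nneg1_Poly.
  have -> : c * d - d * d + d ^+ 2 = c * d by ring.
  have -> : c ^+ 3 - d * (c * d) + d ^+ 2 * d = c ^+ 3 + d ^+ 2 * a.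
    by rewrite /d; ring.
  have -> : d ^+ 2 * (c * d) - d * c ^+ 3 = d * c * (a ^+ 2 + 2 * a * c).
    by rewrite /d; ring.
  by rewrite /= lexx !(addr_ge0, mulr_ge0, exprn_ge0) ?ltW.
have cd : c < d by rewrite ltrDr.
(* The coefficient of ['X^4] is [t * c * (t * d - c^2)], which dictates [t = c^2 / d]. *)
have [t t0 td] : exists2 t, 0 < t & t * d = c ^+ 2.
  by exists (c ^+ 2 / d); rewrite ?divfK ?gt_eqF// divr_gt0 ?exprn_gt0.
have coef4 : t ^+ 2 * (c * d) - t * c ^+ 3 = 0.
  by rewrite (exprS c 2) -td; ring.
have : (N p * Poly [:: 1; - t; t ^+ 2])`_4 = 0.
  apply: cancel_coef; rewrite ?pgE ?coef_Poly//=; apply: nneg1_Poly.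
  rewrite coef4 td.
  have -> : c * d - c ^+ 2 + t ^+ 2 = c * a + t ^+ 2 by rewrite /d; ring.
  have -> : c ^+ 3 - t * (c * d) + t ^+ 2 * d = t ^+ 2 * d.
    by rewrite mulrCA td; ring.
  have td_le : 0 <= d - t.
    by rewrite subr_ge0 -(ler_pM2r d0) td -expr2 ler_pXn2r ?nnegrE ?ltW.
  by rewrite /= td_le lexx !(addr_ge0, mulr_ge0, exprn_ge0) ?ltW.
rewrite Np; move: (N q)`_1 (N q)`_2 => al be.
do 2 rewrite !coefM !(big_ord_recl, big_ord0) /=.
rewrite !coef_Poly /= => E4 E1.
have alE : al = a by move: E1; rewrite /d; lra.
rewrite alE in E4 *.
have /(mulfI (lt0r_neq0 t0)) tE : t * (t * (a * c + be)) = t * (be * c) by lra.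
(* Multiplied by [d], the relation reads [c^2 (ac + be) = be c (a + c)], that is,
   [be * ca = c^2 * ca]. *)
have /(congr1 ( *%R^~ d)) := tE; rewrite mulrAC td /d => dE.
have ca0 : c * a != 0 by rewrite mulf_neq0 ?gt_eqF.
by rewrite (_ : be = c ^+ 2)//; apply: (mulIf ca0); move: dE; lra.
Qed.

Lemma fix_quadratic a c : 0 <= a -> 0 < c ->
  N (Poly [:: 1; a; c ^+ 2]) = Poly [:: 1; a; c ^+ 2].
Proof.
rewrite le_eqVlt => /predU1P[<-|a0] c0; last exact: fix_quadratic_gt0.
have l1 : nneg1 (Poly [:: 1; c ^+ 2]).
  by apply: nneg1_Poly; rewrite /= exprn_ge0// ltW.
(* For [a = 0] the polynomial is linear in ['X^2], and the slope of [contract N] at [c^2] is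
   [(slope N c)^2 = c^2]. *)
have -> : Poly [:: 1; 0; c ^+ 2] = Poly [:: 1; c ^+ 2] \Po 'X^2.
  rewrite /Poly /= !cons_poly_def !(comp_polyD, comp_polyM, comp_polyC, comp_polyX).
  by ring.
rewrite -contract_comp// smult_linear ?exprn_ge0 ?ltW//; last exact: contract_smult.
by rewrite slope_contract// nN.2.
Qed.

End Normalized.

(* With [Q(r, c) = 1 - rcX + c^2X^2], the Graeffe identity
   [Q(r, c) Q(-r, c) = Q(r^2 - 2, c^2)(X^2)] at least doubles the distance of
   [r] to [2], until the coefficients are nonnegative. *)
Lemma extends_fix_quadratic N r c : normalized N -> 0 < c -> r < 2 ->
  extends N (Poly [:: 1; - (r * c); c ^+ 2]) (Poly [:: 1; - (r * c); c ^+ 2]).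
Proof.
move=> nN c0 r2.
have [n rn] : exists n, 2 <= (2 - r) * 2 ^+ n.
  exists (Num.truncn (2 / (2 - r))).
  rewrite mulrC -ler_pdivrMr ?subr_gt0//.
  apply/ltW/(lt_le_trans (truncnS_gt _)).
  by rewrite -natrX ler_nat ltn_expl.
(* [N] is generalized because the Graeffe step passes from [N] to [contract N]. *)
elim: n => [|n IHn] in N nN r c c0 r2 rn *.
  have r0 : 0 <= - (r * c).
    by rewrite -mulNr mulr_ge0 ?(ltW c0)//; move: rn; rewrite expr0; lra.
  rewrite -{2}(fix_quadratic nN r0 c0); apply: extends_nneg1 nN.1 _ _.
  by apply: nneg1_Poly; rewrite /= r0 exprn_ge0 ?ltW.
(* The doubling [(2 - r)(2 + r) >= 2 (2 - r)] needs [r >= 0]; for [r <= 0] already [2 - r >= 2], so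
   the bound holds for [n] as well. *)
have [r0|r0] := leP r 0.
  apply: IHn => //; have : (1 : R) <= 2 ^+ n by rewrite exprn_ege1 ?ler1n.
  nra.
have rc0 : 0 <= r * c by rewrite mulr_ge0 ?ltW.
have w1 : nneg1 (Poly [:: 1; r * c; c ^+ 2]).
  by apply: nneg1_Poly; rewrite /= rc0 exprn_ge0 ?ltW.
have := IHn (contract N) (contract_normalized nN) (r ^+ 2 - 2) (c ^+ 2).
case.
- exact: exprn_gt0.
- nra.
- have : 0 <= (2 : R) ^+ n by rewrite exprn_ge0 ?ler0n.
  move: rn; rewrite exprS; nra.
move=> u [v [u1 v1 uv Nuv]].
have graeffe : Poly [:: 1; r * c; c ^+ 2] * Poly [:: 1; - (r * c); c ^+ 2] =
    Poly [:: 1; - ((r ^+ 2 - 2) * c ^+ 2); (c ^+ 2) ^+ 2] \Po 'X^2.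
  rewrite /Poly /= !cons_poly_def !(comp_polyD, comp_polyM, comp_polyC, comp_polyX).
  by ring.
exists ((u \Po 'X^2) * Poly [:: 1; r * c; c ^+ 2]), (v \Po 'X^2); split.
- by apply: nneg1M => //; exact: nneg1_comp_Xn.
- exact: nneg1_comp_Xn.
- by rewrite -mulrA graeffe -comp_polyM uv.
- rewrite (smultM nN.1)//; last exact: nneg1_comp_Xn.
  rewrite (fix_quadratic nN rc0 c0) -mulrA graeffe -!(contract_comp nN.1)//.
  by rewrite -comp_polyM Nuv.
Qed.

End Contraction.

(** * Factorization over the reals into fixed polynomials *)

Section Factorization.
Context (R : realType).
Implicit Types (p q g : {poly R}) (N : {poly R} -> {poly R}) (c r x y : R).

(** The divisor is [(1 - X/z)(1 - X/z')] with [z = x + iy] and [z'] its conjugate. The remainder is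
    real of degree at most 1 and vanishes at the nonreal point [z], so it is zero. *)
Lemma dvdp_complex_root p x y : y != 0 ->
  root (map_poly (real_complex R) p) (Complex x y) ->
  Poly [:: 1; - (2 * x / (x ^+ 2 + y ^+ 2)); (x ^+ 2 + y ^+ 2)^-1] %| p.
Proof.
move=> y0; set d := x ^+ 2 + y ^+ 2; set m := Poly _ => pz.
have d0 : d != 0 by rewrite paddr_eq0 ?sqr_ge0// !sqrf_eq0 (negPf y0) andbF.
have size_m : (size m <= 3)%N by exact: size_Poly.
have m0 : m != 0.
  apply/eqP => /(congr1 (fun p => p`_0)); rewrite coef_Poly coef0 => /eqP.
  by rewrite oner_eq0.
have mz : root (map_poly (real_complex R) m) (Complex x y).
  rewrite /m /Poly /= !cons_poly_def !(rmorphD, rmorphM)/= !map_polyC map_polyX /=.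
  rewrite rootE !hornerE; apply/eqP/eqP; rewrite eq_complex /=.
  by apply/andP; split; apply/eqP; rewrite /d; field; exact: d0.
have : (size (p %% m)%R <= 2)%N by rewrite -ltnS (leq_trans _ size_m)// ltn_modp.
move=> /poly_mkseq; rewrite /mkseq /= => modE.
have : root (map_poly (real_complex R) (p %% m)) (Complex x y).
  move: pz; rewrite {1}(divp_eq p m) rmorphD rmorphM /= !rootE hornerD hornerM.
  by rewrite (rootP mz) mulr0 add0r.
rewrite modE; move: (p %% m)`_0 (p %% m)`_1 modE => t s modE.
rewrite /Poly /= !cons_poly_def !(rmorphD, rmorphM)/= !map_polyC map_polyX /=.
rewrite rootE !hornerE eq_complex /= => /andP[/eqP re /eqP im].
have s0 : s = 0 by apply: (mulIf y0); lra.
have t0 : t = 0 by rewrite s0 in re; lra.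
by rewrite /dvdp modE s0 t0 /Poly /= !cons_poly_def !polyC0 !(mul0r, add0r).
Qed.

(** Positivity on the half-line passes to the cofactors, unlike nonnegativity of the coefficients,
    and so supports an induction on the size. A complex root is either real, hence negative, or
    nonreal; it yields a linear or a quadratic factor to peel off. *)
Lemma extends_fix N p : normalized N -> p`_0 = 1 ->
  (forall x, 0 <= x -> 0 < p.[x]) -> extends N p p.
Proof.
move=> nN; have smN := nN.1.
have [n] := ubnP (size p); elim: n => // n IHn in p *; rewrite ltnS => pn p01 ppos.
have p0 : p != 0 by apply: contra_eq_neq p01 => ->; rewrite coef0 eq_sym oner_eq0.
have peel q g : p = q * g -> g`_0 = 1 -> (1 < size g)%N ->
    (forall x, 0 <= x -> 0 < g.[x]) -> extends N g g -> extends N p p.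
  move=> pqg g01 sg gpos gg; rewrite pqg; apply: extendsM => //.
  move: p0; rewrite pqg mulf_eq0 negb_or => /andP[q0 g0].
  apply: IHn => [||x x0].
  - move: pn; rewrite pqg size_mul// => pn; rewrite (leq_trans _ pn)//.
    by case: (size g) sg => [|[|k]]// _; rewrite addnS /= addnS ltnS leq_addr.
  - by move: p01; rewrite pqg coef0M g01 mulr1.
  - by have := ppos x x0; rewrite pqg hornerM pmulr_lgt0// gpos.
have [/eqP/size_poly1P[k k0 pk]|sp] := eqVneq (size p) 1%N.
  have -> : p = 1 by move: p01; rewrite pk coefC /= => ->.
  by rewrite -{2}(smult1 smN); apply: extends_nneg1 => //; exact: nneg1_1.
have /closed_rootP[[x y] pz] : size (map_poly (real_complex R) p) != 1%N.
  by rewrite size_map_poly.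
have [y0|y0] := eqVneq y 0.
  have px : root p x.
    by rewrite -(fmorph_root (real_complex R)); move: pz; rewrite y0.
  have x0 : x < 0.
    by rewrite ltNge; apply/negP => /ppos; rewrite (rootP px) ltxx.
  have /factor_theorem[q pE] := px.
  have t0 : 0 <= - x^-1 by rewrite oppr_ge0 invr_le0 ltW.
  apply: (peel ((- x) *: q) (Poly [:: 1; - x^-1])).
  - rewrite pE -scalerAl scalerAr; congr (_ * _).
    rewrite /Poly /= !cons_poly_def -mul_polyC !(mul0r, add0r) mulrDr mulrA.
    by rewrite -polyCM mulrNN divff ?lt_eqF// mul1r mulr1 polyCN.
  - by rewrite coef_Poly.
  - by rewrite (@PolyK _ 1)//= oppr_eq0 invr_eq0 lt_eqF.
  - move=> u u0; rewrite horner_Poly/= mul0r add0r.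
    by rewrite ltr_wpDl// mulr_ge0.
  - rewrite -{2}(fix_linear nN t0); apply: extends_nneg1 => //.
    by apply: nneg1_Poly; rewrite /= t0.
set d := x ^+ 2 + y ^+ 2.
have d0 : 0 < d.
  by rewrite ltr_wpDl ?sqr_ge0// lt_neqAle sqr_ge0 eq_sym sqrf_eq0 y0.
(* In the notation of [extends_fix_quadratic], [c = 1/|z|] and [r = 2x/|z|], which is below 2
   because [z] is not real. *)
have c0 : 0 < (Num.sqrt d)^-1 by rewrite invr_gt0 sqrtr_gt0.
have c2 : (Num.sqrt d)^-1 ^+ 2 = d^-1 by rewrite exprVn sqr_sqrtr// ltW.
have rc : 2 * x / d = 2 * x * (Num.sqrt d)^-1 * (Num.sqrt d)^-1.
  by rewrite -c2; ring.
have /dvdpP[q pE] := dvdp_complex_root y0 pz.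
apply: (peel q _ pE); rewrite -/d.
- by rewrite coef_Poly.
- by rewrite (@PolyK _ 1)//= invr_eq0 gt_eqF.
- move=> u _; rewrite horner_Poly/=.
  have -> : ((0 * u + d^-1) * u + - (2 * x / d)) * u + 1 =
      ((u - x) ^+ 2 + y ^+ 2) / d.
    by rewrite /d; field; rewrite -/d gt_eqF.
  by rewrite divr_gt0// ltr_wpDl ?sqr_ge0// lt_neqAle sqr_ge0 eq_sym sqrf_eq0 y0.
- rewrite rc -c2; apply: extends_fix_quadratic => //.
  rewrite ltr_pdivrMr ?sqrtr_gt0// ltr_pM2l ?ltr0n//.
  rewrite (le_lt_trans (ler_norm x))// -sqrtr_sqr ltr_sqrt// /d ltrDl.
  by rewrite lt_neqAle sqr_ge0 eq_sym sqrf_eq0 y0.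
Qed.

Lemma nneg1_gt0 p x : nneg1 p -> 0 <= x -> 0 < p.[x].
Proof.
move=> p1 x0; have [p01 pge0] := p1.
have sp : (0 < size p)%N by rewrite size_poly_gt0 nneg1_neq0.
rewrite horner_coef (bigD1 (Ordinal sp))//= p01 expr0 mulr1.
by rewrite ltr_pwDl// sumr_ge0// => i _; rewrite mulr_ge0 ?exprn_ge0.
Qed.

(** Rescaling ['X] by the inverse of [slope N 1] normalizes [N], and a normalized map fixes every
    member of [nneg1]. *)
Lemma support_multiplicative_rescale N : support_multiplicative N ->
  exists2 c, 0 < c & forall p, nneg1 p -> N p = p \Po (c *: 'X).
Proof.
move=> smN; have s0 := slope_gt0 smN ltr01; exists (slope N 1) => // p p1.
have cV : 0 < (slope N 1)^-1 by rewrite invr_gt0.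
have nN' : normalized (fun p => N p \Po ((slope N 1)^-1 *: 'X)).
  split=> [|t t0]; first exact: rescale_smult.
  by rewrite slope_rescale slopeE// mulrAC divff ?gt_eqF// mul1r.
have := extends_nneg1_eq nN'.1 p1 (extends_fix nN' p1.1 (fun x => nneg1_gt0 p1)).
move=> Np; rewrite -[in RHS]Np; apply/polyP => i.
by rewrite !coef_comp_polyZX -mulrA -exprMn mulVf ?gt_eqF// expr1n mulr1.
Qed.

End Factorization.

(** * Generating polynomials of measures on a lattice *)

Section GeneratingPolynomial.
Context (R : realType) (S : addset R).
Implicit Types (mu nu : prob S) (p q : {poly R}) (a e x : R).

(** Values of [h] in a module allow monomials, as needed for [genpoly_conv]. *)
Lemma sum_conv (V : lmodType R) (h : R -> V) mu nu :
  \sum_(z <- finsupp (Defs.conv mu nu)) Defs.conv mu nu z *: h z =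
  \sum_(x <- finsupp mu) \sum_(y <- finsupp nu) (mu x * nu y) *: h (x + y).
Proof.
rewrite (big_fset_incl _ (@conv_mass_dom R S mu nu)); last first.
  by move=> z _; rewrite memNfinsupp => /eqP ->; rewrite scale0r.
under eq_bigr do rewrite conv_massE scaler_suml.
rewrite exchange_big/= big_seq [RHS]big_seq; apply: eq_bigr => x xmu.
under eq_bigr do rewrite scaler_suml big_mkcond.
rewrite exchange_big/= big_seq [RHS]big_seq; apply: eq_bigr => y ynu.
rewrite (big_fsetD1 (x + y)) ?in_imfset2//= eqxx big_seq big1 ?addr0// => z.
by rewrite !inE eq_sym => /andP[/negPf ->].
Qed.

Lemma natmulS e n : (S : set R) 0 -> (S : set R) e -> (S : set R) (n%:R * e).
Proof.
move=> S0 Se; elim: n => [|n IHn]; first by rewrite mul0r.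
by rewrite -natr1 mulrDl mul1r; exact: addsetD.
Qed.

Section Dirac.
Context (a : R) (Sa : (S : set R) a).

Definition dirac_mass : {fsfun R -> R with 0} := [fsfun x in [fset a]%fset => 1].

Lemma dirac_massE x : dirac_mass x = (x == a)%:R.
Proof. by rewrite fsfunE inE; case: eqP. Qed.

Lemma finsupp_dirac_mass : finsupp dirac_mass = [fset a]%fset.
Proof.
apply/fsetP => x; rewrite mem_finsupp dirac_massE inE.
by rewrite pnatr_eq0 eqb0 negbK.
Qed.

Lemma dirac_mass_ge0 x : 0 <= dirac_mass x.
Proof. by rewrite dirac_massE ler0n. Qed.

Lemma dirac_mass_sum1 : \sum_(x <- finsupp dirac_mass) dirac_mass x = 1.
Proof. by rewrite finsupp_dirac_mass big_seq_fset1 dirac_massE eqxx. Qed.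

Lemma dirac_mass_supp : [set` finsupp dirac_mass] `<=` S.
Proof. by move=> x /=; rewrite finsupp_dirac_mass inE => /eqP ->. Qed.

Definition pdirac : prob S := Prob dirac_mass_ge0 dirac_mass_sum1 dirac_mass_supp.

Lemma eq_pdirac mu : finsupp mu = [fset a]%fset -> mu = pdirac.
Proof.
move=> mua; apply: prob_eqP => x; rewrite /= dirac_massE.
have [->|xa] := eqVneq x a.
  by have := mass_sum1 mu; rewrite mua big_seq_fset1.
by rewrite fsfun_dflt// mua inE.
Qed.

Lemma conv_pdirac mu x : Defs.conv mu pdirac x = mu (x - a).
Proof.
rewrite /= conv_massE /= finsupp_dirac_mass.
under eq_bigr do rewrite big_mkcond big_seq_fset1 dirac_massE eqxx mulr1.
have addE y : (y + a == x) = (y == x - a) by rewrite eq_sym -subr_eq eq_sym.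
have [xmu|xmu] := boolP (x - a \in finsupp mu).
  rewrite (big_fsetD1 _ xmu) /= addE eqxx big_seq big1 ?addr0// => y.
  by rewrite !inE => /andP[yx _]; rewrite addE (negPf yx).
rewrite [RHS]fsfun_dflt// big_seq big1// => y ymu.
by rewrite addE; case: eqP => // yE; rewrite -yE ymu in xmu.
Qed.

End Dirac.

Section Lattice.
Context (e : R) (e0 : 0 < e).

(** A condition on mass functions, so that [genpoly_surj] can use it before the function is known to
    be a measure. *)
Definition lattice_supp (mu : {fsfun R -> R with 0}) :=
  forall x, x \in finsupp mu -> exists k : nat, x = k%:R * e.

Definition genpoly (mu : {fsfun R -> R with 0}) : {poly R} :=
  \sum_(x <- finsupp mu) mu x *: 'X^(Num.truncn (x / e)).

Lemma truncn_lattice k : Num.truncn (k%:R * e / e) = k.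
Proof. by rewrite mulfK ?gt_eqF// natrK. Qed.

Lemma coef_genpoly (mu : {fsfun R -> R with 0}) i :
  lattice_supp mu -> (genpoly mu)`_i = mu (i%:R * e).
Proof.
move=> muL; rewrite coef_sum; under eq_bigr do rewrite coefZ coefXn.
have neqi x : x \in finsupp mu -> x != i%:R * e -> i != Num.truncn (x / e).
  by move=> /muL[k ->]; apply: contra_neq; rewrite truncn_lattice => ->.
have [imu|imu] := boolP (i%:R * e \in finsupp mu).
  rewrite (big_fsetD1 _ imu) /= truncn_lattice eqxx mulr1 big_seq big1 ?addr0//.
  by move=> x; rewrite !inE => /andP[xi /neqi /(_ xi)/negPf->]; rewrite mulr0.
rewrite [RHS]fsfun_dflt// big_seq big1// => x xmu.
rewrite (negPf (neqi x xmu _)) ?mulr0//; apply: contraNneq imu => <-//.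
Qed.

Lemma horner1_genpoly (mu : {fsfun R -> R with 0}) :
  (genpoly mu).[1] = \sum_(x <- finsupp mu) mu x.
Proof.
rewrite horner_sum; apply: eq_bigr => x _.
by rewrite hornerZ hornerXn expr1n mulr1.
Qed.

Lemma lattice_supp_conv mu nu :
  lattice_supp mu -> lattice_supp nu -> lattice_supp (Defs.conv mu nu).
Proof.
move=> muL nuL x /(fsubsetP (@conv_mass_dom R S mu nu)).
move=> /imfset2P[y /muL[k ->] [z /nuL[l ->] ->]].
by exists (k + l)%N; rewrite natrD mulrDl.
Qed.

Lemma genpoly_conv mu nu : lattice_supp mu -> lattice_supp nu ->
  genpoly (Defs.conv mu nu) = genpoly mu * genpoly nu.
Proof.
move=> muL nuL; rewrite /genpoly sum_conv mulr_suml big_seq [RHS]big_seq.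
apply: eq_bigr => x /muL[k ->]; rewrite mulr_sumr big_seq [RHS]big_seq.
apply: eq_bigr => y /nuL[l ->].
rewrite -mulrDl -natrD !truncn_lattice -scalerAl -scalerAr scalerA.
by rewrite exprD.
Qed.

Lemma genpoly_inj mu nu :
  lattice_supp mu -> lattice_supp nu -> genpoly mu = genpoly nu -> mu = nu.
Proof.
move=> muL nuL eq_gen; apply: prob_eqP => x.
have eqL (k : nat) : mu (k%:R * e) = nu (k%:R * e).
  by rewrite -!coef_genpoly// eq_gen.
have [/muL[k ->]//|xmu] := boolP (x \in finsupp mu).
have [/nuL[k ->]//|xnu] := boolP (x \in finsupp nu).
by rewrite !fsfun_dflt.
Qed.

Lemma genpoly_pdirac a (Sa : (S : set R) a) k : a = k%:R * e -> genpoly (pdirac Sa) = 'X^k.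
Proof.
move=> aE; rewrite /genpoly finsupp_dirac_mass big_seq_fset1 /= dirac_massE eqxx.
by rewrite scale1r aE truncn_lattice.
Qed.

Lemma genpoly_surj p : (S : set R) 0 -> (S : set R) e -> nneg1 p ->
  exists mu, lattice_supp mu /\ genpoly mu = p.[1]^-1 *: p.
Proof.
move=> S0 Se p1; have ps := nneg1_gt0 p1 ler01.
pose s := [seq k%:R * e | k <- iota 0 (size p)].
pose f : {fsfun R -> R with 0} :=
  [fsfun x in [fset x in s]%fset => p.[1]^-1 * p`_(Num.truncn (x / e))].
have fE (k : nat) : f (k%:R * e) = p.[1]^-1 * p`_k.
  rewrite fsfunE truncn_lattice inE /=; case: ifPn => // kNs.
  rewrite nth_default ?mulr0// leqNgt; apply: contra kNs => ks.
  by apply/mapP; exists k; rewrite // mem_iota.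
have fs x : x \in finsupp f -> exists k : nat, x = k%:R * e.
  rewrite mem_finsupp fsfunE inE /=; case: ifPn => [/mapP[k _ ->] _|]; last by rewrite eqxx.
  by exists k.
have f0 x : 0 <= f x.
  have [/fs[k ->]|xf] := boolP (x \in finsupp f); last by rewrite fsfun_dflt.
  by rewrite fE mulr_ge0 ?invr_ge0 ?(ltW ps)//; case: p1.
have genpolyf : genpoly f = p.[1]^-1 *: p.
  by apply/polyP => i; rewrite coef_genpoly// fE coefZ.
have f1 : \sum_(x <- finsupp f) f x = 1.
  by rewrite -horner1_genpoly genpolyf hornerZ mulVf ?gt_eqF.
have fS : [set` finsupp f] `<=` S.
  by move=> x /= /fs[k ->]; exact: natmulS.
by exists (Prob f0 f1 fS).
Qed.

End Lattice.
End GeneratingPolynomial.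

(** * From polynomials back to measures *)

Section Endomorphism.
Context (R : realType) (S : addset R) (Phi : prob S -> prob S).
Context (Phi_supp : support_preserving Phi) (Phi_endo : conv_endomorphism Phi).
Implicit Types (mu nu : prob S) (p q : {poly R}) (a c e x : R).

Lemma Phi_pdirac a (Sa : (S : set R) a) : Phi (pdirac Sa) = pdirac Sa.
Proof. by apply: eq_pdirac; rewrite Phi_supp finsupp_dirac_mass. Qed.

Lemma lattice_supp_Phi e mu : lattice_supp e mu -> lattice_supp e (Phi mu).
Proof. by rewrite /lattice_supp Phi_supp. Qed.

Lemma Phi_eq0 mu x : (Phi mu x == 0) = (mu x == 0).
Proof. by rewrite -[LHS]memNfinsupp -[RHS]memNfinsupp Phi_supp. Qed.

(** The factor [K] is a normalization depending on [mu], whereas [c] depends only on the lattice. *)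
Lemma Phi_lattice e : (S : set R) 0 -> (S : set R) e -> 0 < e ->
  exists2 c, 0 < c & forall mu, lattice_supp e mu ->
    exists K, forall k : nat, Phi mu (k%:R * e) = K * mu (k%:R * e) * c ^+ k.
Proof.
move=> S0 Se e0.
(* [emb] picks a measure whose generating polynomial is proportional to [p]; its values outside
   [nneg1] are irrelevant. *)
have /choice[emb embP] p : exists mu, nneg1 p ->
    lattice_supp e mu /\ genpoly e mu = p.[1]^-1 *: p.
  have [p1|p1] := pselect (nneg1 p); last by exists (pdirac S0).
  by have [mu] := genpoly_surj e0 S0 Se p1; exists mu.
have embL p : nneg1 p -> lattice_supp e (emb p) by case/embP.
have PhiL p : nneg1 p -> lattice_supp e (Phi (emb p)).
  by move=> p1; apply: lattice_supp_Phi; exact: embL.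
have embM p q : nneg1 p -> nneg1 q -> emb (p * q) = Defs.conv (emb p) (emb q).
  move=> p1 q1; have pq1 := nneg1M p1 q1.
  apply: (genpoly_inj e0); [exact: embL|apply: lattice_supp_conv; exact: embL|].
  rewrite genpoly_conv//; [|exact: embL|exact: embL].
  by rewrite !(embP _ _).2// hornerM invfM -scalerAl -scalerAr scalerA.
pose T p := genpoly e (Phi (emb p)).
have T_eq0 p i : nneg1 p -> ((T p)`_i == 0) = (p`_i == 0).
  move=> p1; rewrite coef_genpoly//; last exact: PhiL.
  rewrite Phi_eq0 -coef_genpoly//; last exact: embL.
  rewrite (embP _ p1).2 coefZ mulf_eq0 invr_eq0 gt_eqF//.
  exact: nneg1_gt0.
have T0 p : nneg1 p -> (T p)`_0 != 0.
  by move=> p1; rewrite T_eq0// p1.1 oner_eq0.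
have T_ge0 p i : nneg1 p -> 0 <= (T p)`_i.
  by move=> p1; rewrite coef_genpoly ?mass_ge0//; exact: PhiL.
pose N p := ((T p)`_0)^-1 *: T p.
have smN : support_multiplicative N.
  split=> [p p1|p i p1|p q p1 q1].
  - split=> [|i]; first by rewrite coefZ mulVf// T0.
    by rewrite coefZ mulr_ge0// ?invr_ge0 T_ge0.
  - by rewrite coefZ mulf_eq0 invr_eq0 (negPf (T0 _ p1)) T_eq0.
  - rewrite /N; have -> : T (p * q) = T p * T q.
      by rewrite /T embM// Phi_endo genpoly_conv//; exact: PhiL.
    by rewrite coef0M invfM -scalerAl -scalerAr scalerA.
have [c c0 NE] := support_multiplicative_rescale smN; exists c => // mu muL.
set P := genpoly e mu.
have P1 : P.[1] = 1 by rewrite horner1_genpoly mass_sum1.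
have exP : exists i, P`_i != 0.
  apply/not_existsP => P0; have : P = 0.
    by apply/polyP => i; rewrite coef0; apply/eqP/negP => /negP; exact: P0.
  by move=> PE; move: P1; rewrite PE horner0 => /esym/eqP; rewrite oner_eq0.
(* The measure need not charge 0: [i] is its lowest exponent, and shifting by [i] and dividing by
   [P_i] lands in [nneg1]. *)
pose i := ex_minn exP.
have [Pi Pmin] : P`_i != 0 /\ forall j, (j < i)%N -> P`_j = 0.
  rewrite /i; case: ex_minnP => j Pj jmin; split=> // k kj.
  by apply/eqP; apply: contraTT kj => /jmin; rewrite -leqNgt.
have P_ge0 j : 0 <= P`_j by rewrite coef_genpoly// mass_ge0.
pose p := (P`_i)^-1 *: drop_poly i P.
have p1 : nneg1 p.
  split=> [|j]; rewrite coefZ coef_drop_poly ?add0n ?mulVf//.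
  by rewrite mulr_ge0 ?invr_ge0.
have PE : P = P`_i *: (p * 'X^i).
  apply/polyP => j; rewrite coefZ coefMXn; case: ltnP => ij.
    by rewrite mulr0 Pmin.
  by rewrite coefZ coef_drop_poly subnK// mulVKf.
have p1P : p.[1]^-1 = P`_i.
  apply: (mulIf (lt0r_neq0 (nneg1_gt0 p1 ler01))).
  rewrite mulVf ?gt_eqF ?nneg1_gt0//.
  by move: P1; rewrite {1}PE hornerZ hornerM hornerXn expr1n mulr1.
have Sie := natmulS i S0 Se.
have muE : mu = Defs.conv (emb p) (pdirac Sie).
  have dL : lattice_supp e (pdirac Sie).
    by move=> x; rewrite finsupp_dirac_mass inE => /eqP ->; exists i.
  apply: (genpoly_inj e0) => //; first by apply: lattice_supp_conv => //; exact: embL.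
  rewrite genpoly_conv//; last exact: embL.
  by rewrite (genpoly_pdirac e0 Sie erefl) (embP _ p1).2 p1P -scalerAl -/P {1}PE.
(* [(T p)_0] undoes the normalization in [N], the inverse of [P_i] is the scaling of [p], and [c^-i]
   accounts for the shift. *)
exists ((T p)`_0 * ((P`_i)^-1 / c ^+ i)) => k.
have [ki|ik] := ltnP k i.
  have mu0 : mu (k%:R * e) = 0 by rewrite -coef_genpoly// Pmin.
  by rewrite mu0 mulr0 mul0r; apply/eqP; rewrite Phi_eq0 mu0.
rewrite {1}muE Phi_endo Phi_pdirac conv_pdirac -mulrBl -natrB//.
rewrite -(coef_genpoly e0 _ (PhiL p p1)).
have -> : genpoly e (Phi (emb p)) = (T p)`_0 *: N p.
  by rewrite scalerA divff ?T0// scale1r.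
rewrite NE// coefZ coef_comp_polyZX coefZ coef_drop_poly subnK//.
rewrite -(coef_genpoly e0 k muL).
have -> : c ^+ k = c ^+ (k - i) * c ^+ i by rewrite -exprD subnK.
have : c ^+ i != 0 by rewrite expf_neq0// gt_eqF.
move: (c ^+ (k - i)) (c ^+ i) (P`_i) Pi (P`_k) (T p)`_0 => x y z z0 w t y0.
by field; rewrite z0 y0.
Qed.

(** [D] is a multiplicative set of admissible denominators; translation by [m / d] makes all points
    of [l] nonnegative multiples of [1 / d]. *)
Lemma common_denominator (D : set nat) (l : seq R) :
  D 1%N -> (forall m n, D m -> D n -> D (m * n)%N) ->
  (forall d, D d -> (0 < d)%N) ->
  (forall x, (S : set R) x -> exists d (z : int), D d /\ x = z%:~R / d%:R) ->
  (forall x, x \in l -> (S : set R) x) ->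
  exists d m, D d /\
    forall x, x \in l -> exists k : nat, x + m%:R / d%:R = k%:R / d%:R.
Proof.
move=> D1 DM D0 SD; elim: l => [|y l IHl] lS; first by exists 1%N, 0%N.
have [|d [m [Dd dm]]] := IHl; first by move=> x xl; apply: lS; rewrite inE xl orbT.
have [d' [z [Dd' yE]]] := SD y (lS y (mem_head _ _)).
have dR : d%:R != 0 :> R by rewrite pnatr_eq0 -lt0n D0.
have d'R : d'%:R != 0 :> R by rewrite pnatr_eq0 -lt0n D0.
(* The new translation is [m/d + |z|/d']: the second term makes [y] nonnegative and keeps the
   earlier points so. *)
exists (d * d')%N, (m * d' + absz z * d)%N; split; first exact: DM.
move=> x; rewrite inE => /predU1P[->|/dm[k kE]].
  have [j jE] : exists j : nat, (z + (absz z)%:Z)%R = j%:Z.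
    by case: z {yE} => n; [exists (n + n)%N|exists 0%N; rewrite NegzE /= addNr].
  exists (j * d + m * d')%N; rewrite yE !natrD !natrM.
  have -> : j%:R = z%:~R + (absz z)%:R :> R.
    by rewrite -[j%:R]/(j%:Z%:~R) -jE intrD.
  by field; rewrite dR d'R.
exists (k * d' + absz z * d)%N.
have -> : x = k%:R / d%:R - m%:R / d%:R by rewrite -kE addrK.
by rewrite !natrD !natrM; field; rewrite dR d'R.
Qed.

(** The lattice of step 1 determines [beta]; each measure is then handled on a lattice of step [1/d]
    containing a translate of its support. *)
Lemma Phi_tilt (D : set nat) :
  (S : set R) 0 -> (forall d, D d -> (S : set R) d%:R^-1) ->
  D 1%N -> (forall m n, D m -> D n -> D (m * n)%N) ->
  (forall d, D d -> (0 < d)%N) ->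
  (forall x, (S : set R) x -> exists d (z : int), D d /\ x = z%:~R / d%:R) ->
  exists beta, Phi = tilt beta.
Proof.
move=> S0 SV D1 DM D0 SD.
have S1 : (S : set R) 1 by have := SV _ D1; rewrite invr1.
have [c c0 cP] := Phi_lattice S0 S1 ltr01.
exists (- ln c); apply/funext => mu.
have [d [m [Dd dm]]] := common_denominator D1 DM D0 SD (@mass_supp R S mu).
have d0 : 0 < d%:R :> R by rewrite ltr0n D0.
have dN0 := lt0r_neq0 d0.
have Sd := SV _ Dd.
have dV0 : 0 < d%:R^-1 :> R by rewrite invr_gt0.
have [b b0 bP] := Phi_lattice S0 Sd dV0.
(* The measure with equal masses at 0 and 1 lies on both lattices, and the point 1 has index 1 in
   one and [d] in the other. *)
have bc : b ^+ d = c.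
  have q1 : nneg1 (Poly [:: 1; 1] : {poly R}).
    by apply: nneg1_Poly; rewrite /= ler01.
  have [nu [nuL nuE]] := genpoly_surj ltr01 S0 S1 q1.
  have nuL' : lattice_supp d%:R^-1 nu.
    by move=> x /nuL[k ->]; exists (k * d)%N; rewrite natrM mulfK ?mulr1.
  have nu0E : nu 0 = (Poly [:: 1; 1]).[1]^-1.
    have := coef_genpoly ltr01 0 nuL.
    by rewrite mul0r nuE coefZ coef_Poly mulr1 => <-.
  have nu1E : nu 1 = nu 0.
    have := coef_genpoly ltr01 1 nuL.
    by rewrite mul1r nu0E nuE coefZ coef_Poly mulr1 => <-.
  have nu0 : nu 0 != 0 by rewrite nu0E invr_eq0 gt_eqF ?nneg1_gt0.
  have [K cK] := cP nu nuL; have [L bL] := bP nu nuL'.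
  have := bL 0%N; have := cK 0%N; rewrite !mul0r !expr0 !mulr1 => PhiK PhiL.
  have KL : K = L by apply: (mulIf nu0); rewrite -PhiK.
  have L0 : L != 0.
    by have := Phi_eq0 nu 0; rewrite PhiL mulf_eq0 (negPf nu0) orbF => ->.
  have := bL d; have := cK 1%N.
  by rewrite divff// mul1r nu1E expr1 KL => -> /(mulfI (mulf_neq0 L0 nu0)).
have lnc : ln c = d%:R * ln b by rewrite -bc lnXn// mulr_natl.
have Sa : (S : set R) (m%:R / d%:R) by exact: natmulS.
have [|K KP] := bP (Defs.conv mu (pdirac Sa)).
  move=> x; rewrite mem_finsupp conv_pdirac -mem_finsupp => /dm[k kE].
  by exists k; rewrite -kE subrK.
(* Proportionality to the tilted masses suffices, since total mass 1 then determines [L]. *)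
have [L LP] : exists L, forall x, Phi mu x = L * (mu x * expR (- (- ln c) * x)).
  exists (K * expR (ln c * (m%:R / d%:R))) => x.
  have [xmu|xmu] := boolP (x \in finsupp mu); last first.
    by rewrite !fsfun_dflt ?Phi_supp// mul0r mulr0.
  have [k kE] := dm x xmu; have := KP k.
  rewrite Phi_endo Phi_pdirac !conv_pdirac -kE addrK => ->.
  have -> : b ^+ k = expR (ln c * (m%:R / d%:R)) * expR (ln c * x).
    rewrite -[in LHS](lnK b0) -expRM_natl -expRD -mulrDr [_ + x]addrC kE lnc.
    by congr expR; field.
  by rewrite opprK; ring.
have Z0 := tilt_sum_gt0 (- ln c) mu.
apply: prob_eqP => x; rewrite LP /= tilt_massE [LHS]mulrC; congr (_ * _).
apply: (mulIf (lt0r_neq0 Z0)); rewrite mulVf ?gt_eqF// mulr_sumr.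
rewrite -[RHS](mass_sum1 (Phi mu)) Phi_supp.
by apply: eq_bigr => y _; rewrite LP.
Qed.

End Endomorphism.

Theorem theorem1 (R : realType) (S : addset R)
  (hS : [\/ S = range (fun n : nat => n%:R) :> set R,
            S = range (fun n : int => n%:~R) :> set R
          | S = @rational R :> set R])
  (Phi : prob S -> prob S)
  (Phi_supp : support_preserving Phi)
  (Phi_endo : conv_endomorphism Phi) :
  exists beta : R,
    Phi = tilt beta /\
    forall (mu : prob S) (s : R), (S : set R) s ->
      Phi mu s = mu s * expR (- beta * s) /
                 \sum_(t <- finsupp mu) mu t * expR (- beta * t).
Proof.
suff [beta ->] : exists beta, Phi = tilt beta.
  by exists beta; split=> // mu s _; rewrite /= tilt_massE.
(* The denominators are 1 alone for the naturals and the integers, and all positive naturals for the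
   rationals. *)
have [D [S0 SV D1 DM [D0 SD]]] : exists D : set nat,
    [/\ (S : set R) 0, forall d, D d -> (S : set R) d%:R^-1, D 1%N,
     forall m n, D m -> D n -> D (m * n)%N &
     (forall d, D d -> (0 < d)%N) /\
     forall x, (S : set R) x -> exists d (z : int), D d /\ x = z%:~R / d%:R].
  case: hS => ->.
  - exists [set 1%N]; split=> //; last split=> //.
    + by exists 0%N.
    + by move=> d ->; exists 1%N; rewrite // invr1.
    + by move=> m n -> ->.
    + by move=> d ->.
    + by move=> x [n _ <-]; exists 1%N, n%:Z; rewrite divr1.
  - exists [set 1%N]; split=> //; last split=> //.
    + by exists 0.
    + by move=> d ->; exists 1; rewrite // invr1.
    + by move=> m n -> ->.
    + by move=> d ->.
    + by move=> x [n _ <-]; exists 1%N, n; rewrite divr1.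
  - exists [set d | (0 < d)%N]; split=> //; last split=> //.
    + by exists 0; rewrite // rmorph0.
    + by move=> d _; exists (d%:R^-1); rewrite // fmorphV rmorph_nat.
    + by move=> m n /= m0 n0; rewrite muln_gt0 m0.
    + move=> x [q _ <-]; exists (absz (denq q)), (numq q); split.
        by rewrite /= absz_gt0 denq_neq0.
      by rewrite -[in LHS](divq_num_den q) fmorph_div/= !ratr_int -{1}absz_denq.
exact: (Phi_tilt Phi_supp Phi_endo S0 SV D1 DM D0 SD).
Qed.
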